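(* Let $\lambda_7\in\mathbb{R}$ and let $\lambda=(0,0,0,0,0,-2\lambda_7,\lambda_7,-\lambda_7)$ (a highest weight for $\mathfrak{e}_7$). (1) If $\lambda_7>4$, then $\lambda$ satisfies the strict Dirac inequality for any Schmid module $s_{a,b,c}$, i.e. $\|(\lambda-s_{a,b,c})^{+}+\rho\|^2>\|\lambda+\rho\|^2$ for all $a,b,c\in\mathbb{N}_0$ with $(a,b,c)\neq(0,0,0)$. (2) If $2<\lambda_7<4$, then $\|(\lambda-s_3)^{+}+\rho\|^2<\|\lambda+\rho\|^2$, and the strict Dirac inequality $\|(\lambda-s)^{+}+\rho\|^2>\|\lambda+\rho\|^2$ holds for any Schmid module $s$ of strictly lower level than $s_3$. (3) If $0<\lambda_7<2$, then $\|(\lambda-s_2)^{+}+\rho\|^2<\|\lambda+\rho\|^2$, and the strict Dirac inequality $\|(\lambda-s)^{+}+\rho\|^2>\|\lambda+\rho\|^2$ holds for any Schmid module $s$ of strictly lower level than $s_2$. (4) If $\lambda_7<0$, then the basic Dirac inequality fails, i.e. $\|(\lambda-s_1)^{+}+\rho\|^2<\|\lambda+\rho\|^2$.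
   Context: Setting for $\mathfrak{e}_7$ (Hermitian case). Work in $\mathbb{R}^8$ with the standard inner product $\langle\cdot,\cdot\rangle$ and norm $\|\cdot\|$, and let $\mathbb{N}_0=\{0,1,2,\dots\}$. Let $\varepsilon_i$ be the $i$-th coordinate functional, identified with the $i$-th standard basis vector. Put $\rho=\left(0,1,2,3,4,5,-\frac{17}{2},\frac{17}{2}\right)$ and $\alpha_1=\frac12(\varepsilon_8-\varepsilon_7-\varepsilon_6-\varepsilon_5-\varepsilon_4-\varepsilon_3-\varepsilon_2+\varepsilon_1)$. The group $W_{\mathfrak{k}}$ is generated by the reflections $s_\alpha(\mu)=\mu-\frac{2\langle\mu,\alpha\rangle}{\langle\alpha,\alpha\rangle}\alpha$ for $\alpha=\varepsilon_i\pm\varepsilon_j$ ($5\ge i>j\ge1$) and $\alpha=\alpha_1$. For $\mu\in\mathbb{R}^8$, $\mu^{+}$ denotes the unique $W_{\mathfrak{k}}$-conjugate of $\mu$ that is $\mathfrak{k}$-dominant, i.e. satisfies $|\mu_1|\le\mu_2\le\mu_3\le\mu_4\le\mu_5$ and $\frac12(\mu_8-\mu_7-\mu_6-\mu_5-\mu_4-\mu_3-\mu_2+\mu_1)\ge 0$. A highest weight is a real vector $\lambda=(\lambda_1,\dots,\lambda_6,\lambda_7,-\lambda_7)$ (so $\lambda_8=-\lambda_7$) with $|\lambda_1|\le\lambda_2\le\lambda_3\le\lambda_4\le\lambda_5$, with $\lambda_i-\lambda_j\in\mathbb{Z}$ and $2\lambda_i\in\mathbb{Z}$ for $i,j\in\{1,\dots,5\}$,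 and with $\frac12(\lambda_8-\lambda_7-\lambda_6-\lambda_5-\lambda_4-\lambda_3-\lambda_2+\lambda_1)\in\mathbb{N}_0$. The basic Schmid modules are (represented by) $s_1=(0,0,0,0,0,0,-1,1)$, $s_2=(0,0,0,0,1,1,-1,1)$, $s_3=(0,0,0,0,0,2,-1,1)$. A general Schmid module is $s_{a,b,c}=a s_1+b s_2+c s_3$ with $a,b,c\in\mathbb{N}_0$, $a+b+c>0$; its level is $a+2b+3c$. The Dirac inequality for a Schmid module $s$ is $\|(\lambda-s)^{+}+\rho\|^2\ge\|\lambda+\rho\|^2$; it is called strict if $>$ holds, and it is called the basic Dirac inequality when $s=s_1$. *)

(* Defs.v *)
From mathcomp Require Import all_boot all_order all_algebra.
From mathcomp Require Import boolp classical_sets reals.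

Set Implicit Arguments.
Unset Strict Implicit.
Unset Printing Implicit Defensive.

Import Order.TTheory GRing.Theory Num.Theory.
Local Open Scope ring_scope.

Section E7.
Variable R : realType.
Local Notation V := 'rV[R]_8.

Definition dot (u v : V) : R := \sum_(i < 8) u 0 i * v 0 i.

(* The Euclidean norm; the library's norm on row vectors is the sup norm. *)
Definition enorm (u : V) : R := Num.sqrt (dot u u).

(* Coordinates are numbered from 1 to 8, as on paper, whereas 'I_8 starts
   at 0: [coord u k] and [eps k] are only meant for 1 <= k <= 8. *)
Definition coord (u : V) (k : nat) : R := u 0 (inord k.-1).

Definition eps (k : nat) : V := delta_mx 0 (inord k.-1).

Definition vec8 (s : seq R) : V := \row_(i < 8) s`_i.

Definition rho : V := vec8 [:: 0; 1; 2; 3; 4; 5; - (17 / 2); 17 / 2].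

Definition alpha1 : V :=
  2^-1 *: (eps 8 - eps 7 - eps 6 - eps 5 - eps 4 - eps 3 - eps 2 + eps 1).

Definition reflection (alpha mu : V) : V :=
  mu - (2 * dot mu alpha / dot alpha alpha) *: alpha.

Inductive Wk_root : V -> Prop :=
| Wk_root_sub i j of (1 <= j < i)%N & (i <= 5)%N : Wk_root (eps i - eps j)
| Wk_root_add i j of (1 <= j < i)%N & (i <= 5)%N : Wk_root (eps i + eps j)
| Wk_root_alpha1 : Wk_root alpha1.

(* The group generated by the reflections: since these are involutions, its
   elements are the finite compositions of reflections. *)
Inductive Wk : (V -> V) -> Prop :=
| Wk_id : Wk idfun
| Wk_comp alpha w of Wk_root alpha & Wk w : Wk (reflection alpha \o w).

Definition Wk_conj (mu nu : V) : Prop := exists2 w, Wk w & nu = w mu.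

Definition chain5 (mu : V) : bool :=
  [&& `|coord mu 1| <= coord mu 2, coord mu 2 <= coord mu 3,
      coord mu 3 <= coord mu 4 & coord mu 4 <= coord mu 5].

(* The pairing of mu with alpha1. *)
Definition alpha1_val (mu : V) : R :=
  2^-1 * (coord mu 8 - coord mu 7 - coord mu 6 - coord mu 5 - coord mu 4
          - coord mu 3 - coord mu 2 + coord mu 1).

Definition k_dominant (mu : V) : bool := chain5 mu && (0 <= alpha1_val mu).

(* mu^+ is the k-dominant W_k-conjugate of mu, which exists and is unique, so
   that the default value 0 of [xget] is never used. *)
Definition dom_conj (mu : V) : V :=
  xget 0 [set nu | Wk_conj mu nu /\ k_dominant nu]%classic.

Definition highest_weight (lam : V) : Prop :=
  [/\ coord lam 8 = - coord lam 7,
      chain5 lam,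
      forall i j, (1 <= i <= 5)%N -> (1 <= j <= 5)%N ->
        coord lam i - coord lam j \is a Num.int,
      forall i, (1 <= i <= 5)%N -> 2 * coord lam i \is a Num.int
    & alpha1_val lam \is a Num.nat].

Definition s1 : V := vec8 [:: 0; 0; 0; 0; 0; 0; -1; 1].
Definition s2 : V := vec8 [:: 0; 0; 0; 0; 1; 1; -1; 1].
Definition s3 : V := vec8 [:: 0; 0; 0; 0; 0; 2; -1; 1].

Definition schmid (a b c : nat) : V := s1 *+ a + s2 *+ b + s3 *+ c.

Definition level (a b c : nat) : nat := a + 2 * b + 3 * c.

(* The two sides of the Dirac inequality for the Schmid module s. *)
Definition dirac_lhs (lam s : V) : R := enorm (dom_conj (lam - s) + rho) ^+ 2.
Definition dirac_rhs (lam : V) : R := enorm (lam + rho) ^+ 2.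

Definition strict_dirac (lam s : V) : Prop := dirac_lhs lam s > dirac_rhs lam.

End E7.

Arguments rho {R}.
Arguments alpha1 {R}.
Arguments s1 {R}.
Arguments s2 {R}.
Arguments s3 {R}.
Arguments schmid {R} a b c.

(* Main.v *)
(** Write g1 = e8 - e7 and g3 = e6 - e5. The vector s3 is fixed by W_k, and
    lam - s_{a,b,c} = - (l7 + b + c) s3 - a g1 + b g3. The W_k-orbit of g1 has
    27 elements and contains g3, and some element of W_k swaps the two; hence
    (lam - s_{a,b,c})^+ = - (l7 + b + c) s3 - a g3 + b g1. Uniqueness holds
    because a conjugate has the form nu = - (l7 + b + c) s3 - a x + b y with x, y
    orthogonal in this orbit, and if nu is dominant, its pairing with g1 is at
    least that with y and its pairing with g3 at most that with x, which forces
    y = g1 (if b > 0) and x = g3 (if a > 0). The two sides of the Dirac inequality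
    then differ by
    4 l7 (a + 2b + 3c) + a^2 + (a + 2b + 2c)^2 + 2c^2 - 2a - 20b - 54c. *)

Require Import Defs.
From mathcomp Require Import all_boot all_order all_algebra.
From mathcomp Require Import boolp classical_sets reals.
From mathcomp Require Import zify ring lra.
Import Defs.
Import Order.TTheory GRing.Theory Num.Theory.
Local Open Scope ring_scope.

(** * Integer model of the roots and weights *)

(* A list of eight integers stands for the vector with half those coordinates,
   as the roots and weights at hand have half-integral coordinates. *)
Definition int_dot (s t : seq int) : int :=
  s`_0 * t`_0 + s`_1 * t`_1 + s`_2 * t`_2 + s`_3 * t`_3
  + s`_4 * t`_4 + s`_5 * t`_5 + s`_6 * t`_6 + s`_7 * t`_7.

(* In vector terms the coefficient is int_dot s r / 4, which is 0, 1 or -1 for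
   the lists used here; sgz avoids the division. *)
Definition int_refl (r s : seq int) : seq int :=
  mkseq (fun k => s`_k - sgz (int_dot s r) * r`_k) 8.

Definition int_root (i j : nat) (x : int) : seq int :=
  mkseq (fun k => if k.+1 == i then 2 else if k.+1 == j then x else 0) 8.

Definition int_alpha1 : seq int := [:: 1; -1; -1; -1; -1; -1; -1; 1].

(** Only the 21 roots whose reflections generate W_k are listed, not all 36 positive roots of E6. *)
Definition int_roots : seq (seq int) :=
  int_alpha1 ::
  [seq int_root i j 2 | i <- iota 1 5, j <- iota 1 i.-1]
  ++ [seq int_root i j (-2) | i <- iota 1 5, j <- iota 1 i.-1].

(** Twice the W_k-orbit of e8 - e7. Removing the common component s3 / 3 leaves the 27 weights of a
    minuscule representation of E6. *)
Definition int_weights : seq (seq int) :=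
  [:: [:: 0; 0; 0; 0; 0; 0; -2; 2];
      [:: 2; 0; 0; 0; 0; 2; 0; 0];
      [:: -2; 0; 0; 0; 0; 2; 0; 0];
      [:: 0; 2; 0; 0; 0; 2; 0; 0];
      [:: 0; -2; 0; 0; 0; 2; 0; 0];
      [:: 0; 0; 2; 0; 0; 2; 0; 0];
      [:: 0; 0; -2; 0; 0; 2; 0; 0];
      [:: 0; 0; 0; 2; 0; 2; 0; 0];
      [:: 0; 0; 0; -2; 0; 2; 0; 0];
      [:: 0; 0; 0; 0; 2; 2; 0; 0];
      [:: 0; 0; 0; 0; -2; 2; 0; 0];
      [:: -1; -1; -1; -1; -1; 1; -1; 1];
      [:: -1; -1; -1; 1; 1; 1; -1; 1];
      [:: -1; -1; 1; -1; 1; 1; -1; 1];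
      [:: -1; -1; 1; 1; -1; 1; -1; 1];
      [:: -1; 1; -1; -1; 1; 1; -1; 1];
      [:: -1; 1; -1; 1; -1; 1; -1; 1];
      [:: -1; 1; 1; -1; -1; 1; -1; 1];
      [:: -1; 1; 1; 1; 1; 1; -1; 1];
      [:: 1; -1; -1; -1; 1; 1; -1; 1];
      [:: 1; -1; -1; 1; -1; 1; -1; 1];
      [:: 1; -1; 1; -1; -1; 1; -1; 1];
      [:: 1; -1; 1; 1; 1; 1; -1; 1];
      [:: 1; 1; -1; -1; -1; 1; -1; 1];
      [:: 1; 1; -1; 1; 1; 1; -1; 1];
      [:: 1; 1; 1; -1; 1; 1; -1; 1];
      [:: 1; 1; 1; 1; -1; 1; -1; 1]].

Definition top_weight : seq int := [:: 0; 0; 0; 0; 0; 0; -2; 2].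
Definition bot_weight : seq int := [:: 0; 0; 0; 0; -2; 2; 0; 0].
Definition int_s3 : seq int := [:: 0; 0; 0; 0; 0; 4; -2; 2].

(* Found by breadth-first search on the orbit of pairs of weights. *)
Definition swap_word : seq (seq int) :=
  [:: int_root 5 1 (-2); int_alpha1; int_root 3 2 2; int_root 5 4 2;
      int_alpha1; int_root 5 1 (-2)].

(** The second conjunct is minusculeness: since [int_dot] is four times the scalar product, each
    weight pairs with each root to -1, 0 or 1, which is what justifies [sgz] in [int_refl]. *)
Lemma int_weights_refl :
  all (fun r => all (fun s => (int_refl r s \in int_weights)
       && (int_dot s r == 4 * sgz (int_dot s r))) int_weights) int_roots.
Proof. by vm_compute. Qed.

Lemma int_roots_norm : all (fun r => int_dot r r == 8) int_roots.
Proof. by vm_compute. Qed.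

Lemma int_roots_s3 : all (fun r => int_dot int_s3 r == 0) int_roots.
Proof. by vm_compute. Qed.

(** In true scale, a weight other than [top_weight] pairs with it to at most 1, half the squared
    norm 2. This gap drives the uniqueness of the dominant conjugate. *)
Lemma int_weights_top :
  all (fun s => (0 <= int_dot s top_weight) &&
     ((s == top_weight) || (int_dot s top_weight <= 4))) int_weights.
Proof. by vm_compute. Qed.

Lemma int_weights_bot :
  all (fun s => (0 <= int_dot s bot_weight) &&
     ((s == bot_weight) || (int_dot s bot_weight <= 4))) int_weights.
Proof. by vm_compute. Qed.

Lemma swap_word_top : foldr int_refl top_weight swap_word = bot_weight.
Proof. by vm_compute. Qed.

Lemma swap_word_bot : foldr int_refl bot_weight swap_word = top_weight.
Proof. by vm_compute. Qed.

Lemma swap_word_roots : all (mem int_roots) swap_word.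
Proof. by vm_compute. Qed.

Section HalfIntegral.
Variable R : realType.
Local Notation V := 'rV[R]_8.

Definition half_vec (s : seq int) : V := \row_i ((s`_i)%:~R / 2).

(** * Coordinates, scalar product and half-integral vectors *)

Lemma coord_ord (u : V) (i : 'I_8) : u 0 i = coord u i.+1.
Proof. by rewrite /coord /= inord_val. Qed.

Lemma coordD (u v : V) k : coord (u + v) k = coord u k + coord v k.
Proof. by rewrite /coord mxE. Qed.
Lemma coordN (u : V) k : coord (- u) k = - coord u k.
Proof. by rewrite /coord mxE. Qed.
Lemma coordZ x (u : V) k : coord (x *: u) k = x * coord u k.
Proof. by rewrite /coord mxE. Qed.
Lemma coord_vec8 s k : (k < 8)%N -> coord (@vec8 R s) k.+1 = s`_k.
Proof. by move=> lk; rewrite /coord mxE /= inordK. Qed.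
Lemma coord_half s k : (k < 8)%N -> coord (half_vec s) k.+1 = (s`_k)%:~R / 2.
Proof. by move=> lk; rewrite /coord mxE /= inordK. Qed.
Lemma coord_eps i k : (k < 8)%N -> (0 < i <= 8)%N ->
  coord (eps R i) k.+1 = (i == k.+1)%:R.
Proof.
move=> lk; case: i => // i li; rewrite /coord mxE /=.
by rewrite -val_eqE /= !inordK // eqSS eq_sym.
Qed.

Lemma dotE (u v : V) : dot u v =
  coord u 1 * coord v 1 + coord u 2 * coord v 2 + coord u 3 * coord v 3
  + coord u 4 * coord v 4 + coord u 5 * coord v 5 + coord u 6 * coord v 6
  + coord u 7 * coord v 7 + coord u 8 * coord v 8.
Proof.
rewrite /dot; under eq_bigr do rewrite !coord_ord.
by rewrite !big_ord_recl big_ord0 /= /bump /= !add1n addr0 !addrA.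
Qed.

Lemma coordP (u v : V) :
  (forall k, (k < 8)%N -> coord u k.+1 = coord v k.+1) -> u = v.
Proof. by move=> uv; apply/rowP => i; rewrite !coord_ord uv. Qed.

Lemma dot_half s t : dot (half_vec s) (half_vec t) = (int_dot s t)%:~R / 4.
Proof. by rewrite dotE !coord_half // /int_dot !rmorphD /= !rmorphM /=; field. Qed.

Lemma dotDl (u v w : V) : dot (u + v) w = dot u w + dot v w.
Proof. by rewrite !dotE !coordD; ring. Qed.
Lemma dotZl x (u w : V) : dot (x *: u) w = x * dot u w.
Proof. by rewrite !dotE !coordZ; ring. Qed.
Lemma dotC (u v : V) : dot u v = dot v u.
Proof. by rewrite !dotE; ring. Qed.

Lemma dotDr (u v w : V) : dot w (u + v) = dot w u + dot w v.
Proof. by rewrite !dotE !coordD; ring. Qed.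
Lemma dotZr x (u w : V) : dot w (x *: u) = x * dot w u.
Proof. by rewrite !dotE !coordZ; ring. Qed.

Lemma reflection_half r s : int_dot r r = 8 ->
    int_dot s r = 4 * sgz (int_dot s r) ->
  reflection (half_vec r) (half_vec s) = half_vec (int_refl r s).
Proof.
move=> rr sr; rewrite /reflection !dot_half rr; apply: coordP => k lk.
rewrite coordD coordN coordZ !coord_half // nth_mkseq // {1}sr.
by rewrite rmorphB !rmorphM /=; field.
Qed.

Lemma half_s3 : half_vec int_s3 = s3.
Proof.
by apply: coordP => k lk; rewrite coord_half // coord_vec8 //;
  case: k lk => [|[|[|[|[|[|[|[|]]]]]]]] //= _; field.
Qed.

(** * The group W_k and its action on the weights *)

(** Turns statements about all generating roots into finite checks on lists. *)
Lemma Wk_rootP (alpha : V) :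
  Wk_root alpha <-> exists2 r, r \in int_roots & alpha = half_vec r.
Proof.
have rootE (i j : nat) : (1 <= j < i)%N -> (i <= 5)%N ->
    (eps R i + eps R j = half_vec (int_root i j 2)) *
    (eps R i - eps R j = half_vec (int_root i j (-2))).
  move=> /andP[j0 ji] i5; split; apply: coordP => k lk;
   rewrite coordD ?coordN !coord_eps ?coord_half ?nth_mkseq //; try lia;
   rewrite ?[k.+1 == _]eq_sym.
    case: eqP => [<-|_]; first by rewrite (ltn_eqF ji) /=; field.
    by case: eqP => _ /=; field.
  case: eqP => [<-|_]; first by rewrite (ltn_eqF ji) /=; field.
  by case: eqP => _ /=; field.
have alphaE : alpha1 = half_vec int_alpha1.
  apply: coordP => k lk.
  rewrite /alpha1 coordZ !coordD !coordN !coord_eps // coord_half //.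
  by case: k lk => [|[|[|[|[|[|[|[|]]]]]]]] //= _; field.
have mem_root (i j : nat) : (1 <= j < i)%N -> (i <= 5)%N ->
    (i \in iota 1 5) && (j \in iota 1 i.-1).
  by rewrite !mem_iota; lia.
split.
  case=> [i j ji i5|i j ji i5|]; last by exists int_alpha1; rewrite // mem_head.
    have /andP[mi mj] := mem_root _ _ ji i5.
    exists (int_root i j (-2)); last by rewrite rootE.
    rewrite inE mem_cat; apply/orP; right; apply/orP; right.
    by apply/allpairsPdep; exists i, j.
  have /andP[mi mj] := mem_root _ _ ji i5.
  exists (int_root i j 2); last by rewrite rootE.
  rewrite inE mem_cat; apply/orP; right; apply/orP; left.
  by apply/allpairsPdep; exists i, j.
case=> r; rewrite inE mem_cat => /orP[/eqP->->|].
  by rewrite -alphaE; constructor.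
by case/orP => /allpairsPdep[i [j [+ + -> ->]]]; rewrite !mem_iota => mi mj;
  rewrite -rootE; try lia; constructor; lia.
Qed.

Lemma reflection_linear (r u v : V) x :
  reflection r (x *: u + v) = x *: reflection r u + reflection r v.
Proof.
apply: coordP => k _; rewrite /reflection !(coordD, coordN, coordZ) dotDl dotZl.
by ring.
Qed.

Lemma Wk_linear (w : V -> V) x u v : Wk w -> w (x *: u + v) = x *: w u + w v.
Proof. by elim=> // alpha w' _ _ IH; rewrite /= IH reflection_linear. Qed.

Lemma Wk_dot (w : V -> V) u v : Wk w -> dot (w u) (w v) = dot u v.
Proof.
elim=> // alpha w' /Wk_rootP[r rr ->] _ /= IH.
have norm2 : dot (half_vec r) (half_vec r) = 2.
  by rewrite dot_half (eqP (allP int_roots_norm r rr)); field.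
rewrite /reflection norm2 -!scaleNr.
rewrite !(dotDl, dotZl, dotDr, dotZr) norm2 IH [dot (half_vec r) _]dotC.
by field.
Qed.

Lemma Wk_s3 (w : V -> V) : Wk w -> w s3 = s3.
Proof.
elim=> // alpha w' /Wk_rootP[r rr ->] _ /= ->.
rewrite /reflection -half_s3 dot_half (eqP (allP int_roots_s3 r rr)).
by rewrite mul0r mulr0 mul0r scale0r subr0.
Qed.

Lemma reflection_weight r s : r \in int_roots -> s \in int_weights ->
  reflection (half_vec r) (half_vec s) = half_vec (int_refl r s)
  /\ int_refl r s \in int_weights.
Proof.
move=> rr ss; have /andP[ws /eqP sE] := allP (allP int_weights_refl r rr) s ss.
by split=> //; apply: reflection_half => //; apply/eqP/(allP int_roots_norm).
Qed.

Lemma Wk_weight (w : V -> V) s : Wk w -> s \in int_weights ->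
  exists2 t, t \in int_weights & w (half_vec s) = half_vec t.
Proof.
move=> + ss; elim=> [|alpha w' /Wk_rootP[r rr ->] _ [t tt /= ->]]; first by exists s.
by have [-> wt] := reflection_weight r t rr tt; exists (int_refl r t).
Qed.

Lemma Wk_swap : exists2 w : V -> V, Wk w &
  w (half_vec top_weight) = half_vec bot_weight /\
  w (half_vec bot_weight) = half_vec top_weight.
Proof.
(* The induction on the word carries membership in [int_weights], which is what lets [int_refl]
   represent the next reflection. *)
have [w Ww wE] : exists2 w : V -> V, Wk w & forall s, s \in int_weights ->
    w (half_vec s) = half_vec (foldr int_refl s swap_word)
    /\ foldr int_refl s swap_word \in int_weights.
  elim: swap_word swap_word_roots => [_|r rs IH /andP[rr /IH[w Ww wE]]].
    by exists idfun; [constructor|].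
  exists (reflection (half_vec r) \o w).
    by constructor=> //; apply/Wk_rootP; exists r.
  by move=> s /wE[/= -> ws]; apply: reflection_weight.
exists w => //; split.
  by rewrite -swap_word_top; apply: (wE _ _).1.
by rewrite -swap_word_bot; apply: (wE _ _).1.
Qed.

(** * Dominant conjugates *)

(** [top_weight] is the highest and [bot_weight] the lowest weight: top minus s and s minus bot are
    nonnegative combinations of the six simple roots, whose pairings with [nu] are nonnegative by
    dominance. [lra] finds the combination for each of the 27 weights. *)
Lemma dominant_weight_bound (nu : V) s : k_dominant nu -> s \in int_weights ->
  dot (half_vec bot_weight) nu <= dot (half_vec s) nu
    <= dot (half_vec top_weight) nu.
Proof.
case/andP=> /and4P[]; rewrite ler_norml => /andP[h1 h2] h3 h4 h5.
rewrite /alpha1_val => h6; rewrite !dotE !coord_half //.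
rewrite !in_cons in_nil.
move: (coord nu 1) (coord nu 2) (coord nu 3) (coord nu 4) (coord nu 5)
  (coord nu 6) (coord nu 7) (coord nu 8) h1 h2 h3 h4 h5 h6.
move=> n1 n2 n3 n4 n5 n6 n7 n8 h1 h2 h3 h4 h5 h6.
by do 27![case/predU1P => [->|]; first by rewrite /=; apply/andP; split; lra].
Qed.

Lemma dom_conj_weights (p a b : R) : 0 <= a -> 0 <= b ->
  dom_conj (p *: s3 + (b *: half_vec bot_weight - a *: half_vec top_weight)) =
  p *: s3 + (b *: half_vec top_weight - a *: half_vec bot_weight).
Proof.
move=> a0 b0; rewrite -!scaleNr.
have topW : top_weight \in int_weights by [].
have botW : bot_weight \in int_weights by [].
have WkE w (u v : V) : Wk w -> w (p *: s3 + (b *: u + (- a) *: v)) =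
    p *: s3 + (b *: w u + (- a) *: w v).
  move=> Ww; rewrite (Wk_linear w p) // (Wk_linear w b) // (Wk_s3 w) //; congr (_ + (_ + _)).
  have w0 : w 0 = 0.
    by have := Wk_linear w (-1) 0 0 Ww; rewrite !scaleN1r !addNr.
  by have := Wk_linear w (- a) v 0 Ww; rewrite w0 !addr0.
apply: xget_unique; first split.
- by have [w Ww [wt wb]] := Wk_swap; exists w => //; rewrite WkE // wt wb.
(* The first four coordinates vanish, the fifth is [a], and the pairing with [alpha1] is [b]. *)
- rewrite /k_dominant /chain5 /alpha1_val !coordD !coordZ !coord_half //.
  rewrite !coord_vec8 //= ler_norml; apply/andP; split; last lra.
  by apply/and4P; split; try lra; apply/andP; split; lra.
move=> nu [[w Ww ->]]; rewrite WkE //.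
have xy : dot (w (half_vec top_weight)) (w (half_vec bot_weight)) = 0.
  by rewrite Wk_dot // dot_half mul0r.
have [x xW xE] := Wk_weight w _ Ww topW; have [y yW yE] := Wk_weight w _ Ww botW.
rewrite xE yE in xy *; move=> dom.
(* With x.y = 0 and the [s3] terms cancelling, the two bounds become 2b <= b y.top - a x.top and 2a
   + b y.bot <= a x.bot. *)
have /andP[_] := dominant_weight_bound _ _ dom yW.
have /andP[+ _] := dominant_weight_bound _ _ dom xW.
have s3W s : s \in int_weights -> dot (half_vec s) s3 = 2.
  move=> sW; rewrite -half_s3 dot_half.
  have /allP/(_ s sW)/eqP -> : all (fun s => int_dot s int_s3 == 8) int_weights.
    by vm_compute.
  by field.
have normW s : s \in int_weights -> dot (half_vec s) (half_vec s) = 2.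
  move=> sW; rewrite dot_half.
  have /allP/(_ s sW)/eqP -> : all (fun s => int_dot s s == 8) int_weights.
    by vm_compute.
  by field.
have bnd t s : all (fun s => (0 <= int_dot s t) &&
     ((s == t) || (int_dot s t <= 4))) int_weights -> s \in int_weights ->
    0 <= dot (half_vec s) (half_vec t) /\
    (s = t \/ dot (half_vec s) (half_vec t) <= 1).
  move=> /allP/[apply]/andP[ge0 le4]; rewrite dot_half; split.
    by rewrite divr_ge0 // ler0z.
  case/orP: le4 => [/eqP|]; first by left.
  by rewrite -(ler_int R) => le4; right; rewrite ler_pdivrMr // mul1r.
rewrite !dotDr !dotZr !s3W // ?normW // [dot (half_vec y) (half_vec x)]dotC xy.
rewrite ![dot (half_vec top_weight) _]dotC ![dot (half_vec bot_weight) _]dotC.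
have [xt0 _] := bnd _ _ int_weights_top xW.
have [yb0 _] := bnd _ _ int_weights_bot yW.
have [_ xb] := bnd _ _ int_weights_bot xW.
have [_ yt] := bnd _ _ int_weights_top yW.
have := mulr_ge0 a0 xt0; have := mulr_ge0 b0 yb0 => byb axt dx dy.
(* Either y is the top weight, or y.top <= 1 gives 2b <= b, so b = 0 and the term vanishes whatever
   y is. The same argument applies to x, a and the bottom weight. *)
congr (_ + (_ + _)).
  have [->//|yt1] := yt.
  suff -> : b = 0 by rewrite !scale0r.
  by apply/eqP; rewrite eq_le b0 andbT; have := ler_wpM2l b0 yt1; lra.
have [->//|xb1] := xb.
suff -> : a = 0 by rewrite oppr0 !scale0r.
by apply/eqP; rewrite eq_le a0 andbT; have := ler_wpM2l a0 xb1; lra.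
Qed.

(** * The Dirac inequality *)

Lemma enorm_sq (u : V) : enorm u ^+ 2 = dot u u.
Proof. by rewrite sqr_sqrtr // sumr_ge0 // => i _; apply: sqr_ge0. Qed.

Lemma dirac_gap (l7 : R) (a b c : nat)
    (lam := vec8 [:: 0; 0; 0; 0; 0; - (2 * l7); l7; - l7] : V) :
  dirac_lhs lam (schmid a b c) - dirac_rhs lam =
  4 * l7 * (a%:R + 2 * b%:R + 3 * c%:R) + a%:R ^+ 2
  + (a%:R + 2 * b%:R + 2 * c%:R) ^+ 2 + 2 * c%:R ^+ 2
  - 2 * a%:R - 20 * b%:R - 54 * c%:R.
Proof.
(* Here lam = - l7 s3, while s1 is the top weight and s2 is s3 minus the bottom weight. *)
have dec : lam - schmid a b c = (- (l7 + b%:R + c%:R)) *: s3 +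
    (b%:R *: half_vec bot_weight - a%:R *: half_vec top_weight).
  apply: coordP => k lk; rewrite /schmid -!scaler_nat.
  rewrite !(coordD, coordN, coordZ) !coord_half // !coord_vec8 //.
  by case: k lk => [|[|[|[|[|[|[|[|]]]]]]]] //= _; field.
rewrite /dirac_lhs dec dom_conj_weights ?ler0n // /dirac_rhs !enorm_sq.
rewrite !dotE !(coordD, coordN, coordZ) !coord_half // !coord_vec8 //=.
by field.
Qed.
End HalfIntegral.

Theorem theorem2p9 (R : realType) (l7 : R) (lam : 'rV[R]_8)
    (lamE : lam = vec8 [:: 0; 0; 0; 0; 0; - (2 * l7); l7; - l7]) :
  highest_weight lam /\
  [/\ 4 < l7 -> forall a b c : nat, (0 < a + b + c)%N ->
        strict_dirac lam (schmid a b c),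
      2 < l7 < 4 ->
        dirac_lhs lam s3 < dirac_rhs lam /\
        (forall a b c : nat, (0 < a + b + c)%N ->
           (level a b c < level 0 0 1)%N -> strict_dirac lam (schmid a b c)),
      0 < l7 < 2 ->
        dirac_lhs lam s2 < dirac_rhs lam /\
        (forall a b c : nat, (0 < a + b + c)%N ->
           (level a b c < level 0 1 0)%N -> strict_dirac lam (schmid a b c))
    & l7 < 0 -> dirac_lhs lam s1 < dirac_rhs lam].
Proof.
have gap := dirac_gap R l7; rewrite -lamE in gap.
have s1E : s1 = schmid 1 0 0 :> 'rV[R]_8 by rewrite /schmid !mulr0n !addr0.
have s2E : s2 = schmid 0 1 0 :> 'rV[R]_8 by rewrite /schmid !mulr0n addr0 add0r.
have s3E : s3 = schmid 0 0 1 :> 'rV[R]_8 by rewrite /schmid !mulr0n !add0r.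
split.
  have coord0 i : (1 <= i <= 5)%N -> coord lam i = 0.
    by rewrite lamE; case: i => [|[|[|[|[|[|]]]]]] // _; rewrite coord_vec8.
  split=> [||i j hi hj|i hi|].
  - by rewrite lamE !coord_vec8.
  - by rewrite /chain5 !coord0 // normr0 lexx.
  - by rewrite !coord0 // subr0.
  - by rewrite coord0 // mulr0.
  - suff -> : alpha1_val lam = 0 by [].
    by rewrite /alpha1_val lamE !coord_vec8 //=; field.
split.
- move=> l4 a b c abc; rewrite /strict_dirac -subr_gt0 gap.
  (* At l7 = 4 the gap is a^2 + (a + 2b + 2c)^2 + 2c^2 + 14a + 12b - 6c, whose only negative term is
     absorbed by 6c^2 because c is a natural number. It vanishes at s3, so the threshold 4 is
     sharp. *)
  have c2 : 0 <= c%:R ^+ 2 - c%:R :> R.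
    by rewrite subr_ge0 -natrX ler_nat; case: (c) => // n; rewrite leq_pmulr.
  have a0 : 0 <= a%:R :> R by []; have b0 : 0 <= b%:R :> R by [].
  have c0 : 0 <= c%:R :> R by [].
  have lev : 0 < a%:R + 2 * b%:R + 3 * c%:R :> R.
    have : 0 < (a + b + c)%:R :> R by rewrite ltr0n.
    by rewrite !natrD; lra.
  have : 0 < (l7 - 4) * (a%:R + 2 * b%:R + 3 * c%:R) by rewrite mulr_gt0 ?subr_gt0.
  by have := mulr_ge0 a0 b0; have := mulr_ge0 a0 c0; have := mulr_ge0 b0 c0; nra.
(* The gap at s3 is 12 (l7 - 4). Level below 3 leaves (1,0,0), (2,0,0) and (0,1,0), with gaps 4 l7,
   8 l7 + 4 and 8 (l7 - 2). *)
- move=> /andP[l2 l4]; split; first by rewrite -subr_lt0 s3E gap; lra.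
  move=> a b c abc lev; rewrite /strict_dirac -subr_gt0 gap; move: abc lev.
  rewrite /level; case: c => [|c]; last lia.
  case: b => [|[|b]]; last lia.
    by case: a => [|[|[|a]]]; try lia; move=> _ _; lra.
  by case: a => [|a]; try lia; move=> _ _; lra.
(* The gap at s2 is 8 (l7 - 2), and only s1, with gap 4 l7, has lower level. *)
- move=> /andP[l0 l2]; split; first by rewrite -subr_lt0 s2E gap; lra.
  move=> a b c abc lev; rewrite /strict_dirac -subr_gt0 gap; move: abc lev.
  rewrite /level; case: c => [|c]; last lia; case: b => [|b]; last lia.
  by case: a => [|[|a]]; try lia; move=> _ _; lra.
- by move=> l0; rewrite -subr_lt0 s1E gap; lra.
Qed.
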